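(* Let $(X_k)_{k\in\mathbb{Z}}$ be Banach spaces, let $T_k\in L(X_k,X_{k-1})$ for $k\in\mathbb{Z}$ with $\sup_{k\in\mathbb{Z}}\|T_k\|<\infty$, and let $B_{(T_k)}$ be the associated shift operator on $c_0((X_k)_k,\mathbb{Z})$ or on $\ell^p((X_k)_k,\mathbb{Z})$ with $1\le p<\infty$. The following assertions are equivalent: (1) $B_{(T_k)}$ is hypercyclic; (2) $B_{(T_k)}$ is weakly mixing; (3) for every $N\ge 1$ and all families $(U_j)_{-N\le j\le N}$, $(V_j)_{-N\le j\le N}$, where the sets $U_j$ and $V_j$ are non-empty open subsets of $X_j$, there exists $n\in\mathbb{N}$ such that for every $-N\le j\le N$, $$T_{j-n,j}U_j\cap B_{j-n}(0,1)\neq\emptyset\quad\text{and}\quad T_{j,j+n}B_{j+n}(0,1)\cap V_j\neq\emptyset .$$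
   Context: $\mathbb{N}=\{1,2,3,\dots\}$; Banach spaces are over $\mathbb{K}=\mathbb{R}$ or $\mathbb{C}$, and $L(X,Z)$ denotes the bounded linear operators from $X$ to $Z$. $\ell^p((X_k)_k,\mathbb{Z})=\{(x_k)_{k}\in\prod_{k\in\mathbb{Z}} X_k:\sum_k\|x_k\|^p<\infty\}$ with norm $(\sum_k\|x_k\|^p)^{1/p}$, and $c_0((X_k)_k,\mathbb{Z})=\{(x_k)_k\in\prod_{k\in\mathbb{Z}} X_k:\lim_{|k|\to\infty}\|x_k\|=0\}$ with norm $\sup_k\|x_k\|$. The shift is $B_{(T_k)}(x_k)_{k\in\mathbb{Z}}=(T_{k+1}x_{k+1})_{k\in\mathbb{Z}}$; it is a bounded operator on these spaces exactly when $\sup_k\|T_k\|<\infty$. For $k<n$, $T_{k,n}=T_{k+1}\circ\cdots\circ T_n\in L(X_n,X_k)$. $B_k(x,r)$ is the open ball of $X_k$ centered at $x$ with radius $r$. An operator $S$ on a Banach space $Y$ is hypercyclic if some $y\in Y$ has dense orbit $\{S^ny:n\ge 0\}$, and weakly mixing if $S\oplus S$ is hypercyclic on $Y\oplus Y$.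
   Formalization: The formal theorem additionally assumes every Banach space X_k is separable; without this (3) does not imply (1), e.g. X_k = l^2(uncountable), T_k = 2·id for k ≥ 1 and T_k = (1/2)·id for k ≤ 0. *)

(* Defs.v *)
From HB Require Import structures.
From mathcomp Require Import all_boot all_order all_algebra.
From mathcomp Require Import complex finmap.
From mathcomp Require Import all_classical all_reals all_analysis.
From mathcomp Require Import ring lra zify.

Set Implicit Arguments.
Unset Strict Implicit.
Unset Printing Implicit Defensive.

Import Order.TTheory GRing.Theory Num.Theory.
Import numFieldNormedType.Exports.

Local Open Scope classical_set_scope.
Local Open Scope ring_scope.

Inductive scalars := real_scalars | complex_scalars.

Definition scalar_field (R : realType) (s : scalars) : numFieldType :=
  match s with
  | real_scalars => R
  | complex_scalars => (R[i])%C
  end.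

Definition of_real (R : realType) (s : scalars) : R -> scalar_field R s :=
  match s with
  | real_scalars => id
  | complex_scalars => fun r => (r%:C)%C
  end.

Definition to_real (R : realType) (s : scalars) : scalar_field R s -> R :=
  match s with
  | real_scalars => id
  | complex_scalars => @complex.Re R
  end.

Section ScalarTheory.
Variables (R : realType) (s : scalars).
Local Notation K := (scalar_field R s).

Lemma of_realK (r : R) : to_real (of_real s r) = r.
Proof. by case: s. Qed.

Lemma to_realK (a : K) : 0 <= a -> of_real s (to_real a) = a.
Proof.
case: s a => //= a a0; apply: RRe_real.
by rewrite realE a0.
Qed.

Lemma of_realD (x y : R) : of_real s (x + y) = of_real s x + of_real s y.
Proof. by case: s => //=; rewrite rmorphD. Qed.

Lemma of_realM (x y : R) : of_real s (x * y) = of_real s x * of_real s y.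
Proof. by case: s => //=; rewrite rmorphM. Qed.

Lemma of_real0 : of_real s (0 : R) = 0.
Proof. by case: s. Qed.

Lemma of_real1 : of_real s (1 : R) = 1.
Proof. by case: s. Qed.

Lemma ler_of_real (x y : R) : (of_real s x <= of_real s y) = (x <= y).
Proof. by case: s => //=; rewrite lecR. Qed.

Lemma of_real_inj : injective (@of_real R s).
Proof. by move=> x y xy; rewrite -(of_realK x) xy of_realK. Qed.

End ScalarTheory.

(* The library norm of a [normedModType K] takes its values in [K]. *)
Definition rnorm (R : realType) (s : scalars)
  (V : normedModType (scalar_field R s)) (x : V) : R := to_real `|x|.

Section RNorm.
Variables (R : realType) (s : scalars) (V : normedModType (scalar_field R s)).
Implicit Types x y : V.

Lemma of_real_rnorm x : of_real s (rnorm x) = `|x|.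
Proof. exact: to_realK. Qed.

Lemma rnorm_ge0 x : 0 <= rnorm x.
Proof. by rewrite -(ler_of_real s) of_real_rnorm of_real0. Qed.

Lemma rnorm0 : rnorm (0 : V) = 0.
Proof. by apply: (@of_real_inj _ s); rewrite of_real_rnorm of_real0 normr0. Qed.

Lemma rnorm_eq0 x : rnorm x = 0 -> x = 0.
Proof.
by move=> x0; apply: normr0_eq0; rewrite -of_real_rnorm x0 of_real0.
Qed.

Lemma ler_rnormD x y : rnorm (x + y) <= rnorm x + rnorm y.
Proof. by rewrite -(ler_of_real s) of_realD !of_real_rnorm ler_normD. Qed.

Lemma rnormZ (a : scalar_field R s) x :
  rnorm (a *: x) = to_real `|a| * rnorm x.
Proof.
by apply: (@of_real_inj _ s); rewrite of_realM !of_real_rnorm to_realK// normrZ.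
Qed.

End RNorm.

Section OpNorm.
Variables (R : realType) (s : scalars).
Local Notation K := (scalar_field R s).
Local Open Scope ereal_scope.

Definition op_norm (V W : normedModType K) (f : V -> W) : \bar R :=
  ereal_sup [set (rnorm (f x))%:E | x in [set x : V | (rnorm x <= 1)%R]].

Lemma rnorm_op_norm (V W : normedModType K) (f : {linear V -> W}) (M : R) x :
  op_norm f <= M%:E -> (rnorm (f x) <= M * rnorm x)%R.
Proof.
move=> fM; have [x0|x0] := eqVneq (rnorm x) 0%R.
  by rewrite (rnorm_eq0 x0) linear0 !rnorm0 mulr0.
have xgt0 : (0 < rnorm x)%R by rewrite lt_neqAle eq_sym x0 rnorm_ge0.
have iE : to_real `|of_real s (rnorm x)^-1| = (rnorm x)^-1%R.
  rewrite ger0_norm ?of_realK// -(@of_real0 R s) ler_of_real invr_ge0.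
  exact: ltW.
have : ((rnorm (f (of_real s (rnorm x)^-1 *: x)))%:E <= M%:E).
  apply: le_trans fM; apply: ereal_sup_ubound.
  by exists (of_real s (rnorm x)^-1 *: x) => //=; rewrite rnormZ iE mulVf.
by rewrite linearZ/= rnormZ iE lee_fin mulrC ler_pdivrMr.
Qed.

End OpNorm.

Inductive seq_kind (R : realType) :=
  | kind_c0
  | kind_lp (p : R) of 1 <= p.
Arguments kind_c0 {R}.

Section SeqKind.
Variable R : realType.
Implicit Types (e : seq_kind R) (a b : int -> R).

(* [kind_mem] and [kind_norm] are only applied to sequences of norms, hence
   there are no absolute values. *)
Definition kind_mem e a : Prop :=
  match e with
  | kind_c0 =>
      forall eps : R, 0 < eps ->
        exists m : nat, forall k : int, (m <= `|k|)%N -> a k < eps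
  | @kind_lp _ p _ => (\esum_(k in [set: int]) (a k `^ p)%:E < +oo)%E
  end.

Definition kind_norm e a : R :=
  match e with
  | kind_c0 => sup (range a)
  | @kind_lp _ p _ =>
      (fine (\esum_(k in [set: int]) (a k `^ p)%:E)%E) `^ p^-1
  end.

(* For a nonnegative [a] in the space: [a] has norm at most [M]. *)
Definition kind_le e a (M : R) : Prop :=
  match e with
  | kind_c0 => forall k, a k <= M
  | @kind_lp _ p _ =>
      forall F : {fset int}, \sum_(k <- F) a k `^ p <= M `^ p
  end.

Let nneg a := forall k, 0 <= a k.

Lemma esum_leP (f : int -> R) (M : R) :
  (\esum_(k in [set: int]) (f k)%:E <= M%:E)%E <->
  forall F : {fset int}, \sum_(k <- F) f k <= M.
Proof.
split=> [fM F|fM].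
  rewrite -lee_fin; apply: le_trans fM; apply: ereal_sup_ubound.
  exists [set` F]; first by split.
  by rewrite fsbig_finite//= set_fsetK sumEFin.
apply: ge_ereal_sup => _ [X [finX _]] <-.
by rewrite fsbig_finite//= sumEFin lee_fin.
Qed.

Lemma kind_mem_le e a : nneg a -> kind_mem e a -> kind_le e a (kind_norm e a).
Proof.
move=> a0; case: e => [a_c0 k|p p1 /= afin] /=.
  apply: ub_le_sup; last by exists k.
  have [m am] := a_c0 1 ltr01.
  exists (1 + \sum_(i < m) (a i%:Z + a (- i%:Z))) => _ [j _ <-].
  have sge0 i : 0 <= a i%:Z + a (- i%:Z) by rewrite addr_ge0.
  have [/am/ltW aj|jm] := leqP m `|j|%N.
    by rewrite (le_trans aj)// lerDl sumr_ge0.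
  apply: le_trans (_ : a j <= a (`|j|%N)%:Z + a (- (`|j|%N)%:Z)) _.
    by case: (intP j) => [|n|n]; rewrite ?abszN /= ?lerDl ?lerDr.
  rewrite (bigD1 (Ordinal jm))//= addrCA lerDl addr_ge0// sumr_ge0//.
have p0 : 0 < p by apply: lt_le_trans p1.
apply/esum_leP; rewrite -powRrM mulVf ?gt_eqF// powRr1; last first.
  by rewrite fine_ge0// esum_ge0// => k _; rewrite lee_fin powR_ge0.
rewrite fineK// ge0_fin_numE// esum_ge0// => k _.
by rewrite lee_fin powR_ge0.
Qed.

Lemma kind_norm_le e a M :
  nneg a -> 0 <= M -> kind_le e a M -> kind_norm e a <= M.
Proof.
move=> a0 M0; case: e => [aM|p p1 /esum_leP aM] /=.
  by apply: ge_sup => [|_ [k _ <-]//]; exists (a 0); exists 0.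
have p0 : 0 < p by apply: lt_le_trans p1.
have s0 : (0 <= \esum_(k in [set: int]) (a k `^ p)%:E)%E.
  by apply: esum_ge0 => k _; rewrite lee_fin powR_ge0.
have sfin : (\esum_(k in [set: int]) (a k `^ p)%:E)%E \is a fin_num.
  by rewrite ge0_fin_numE// (le_lt_trans aM)// ltry.
rewrite -[leRHS](powRr1 M0) -(mulfV (lt0r_neq0 p0)) powRrM.
rewrite ge0_ler_powR ?invr_ge0 ?(ltW p0)// ?nnegrE ?fine_ge0 ?powR_ge0//.
by rewrite -lee_fin fineK.
Qed.

Lemma kind_norm_ge0 e a : nneg a -> kind_mem e a -> 0 <= kind_norm e a.
Proof.
move=> a0; case: e => [am|p p1 _] /=; last exact: powR_ge0.
exact: le_trans (a0 0) (kind_mem_le a0 am 0).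
Qed.

Lemma kind_le_pt e a M k : nneg a -> 0 <= M -> kind_le e a M -> a k <= M.
Proof.
move=> a0 M0; case: e => [//|p p1 /(_ [fset k]%fset)].
have p0 : 0 < p by apply: lt_le_trans p1.
rewrite big_seq_fset1 => aM; rewrite leNgt; apply/negP => Mk.
by move: aM; rewrite leNgt gt0_ltr_powR ?nnegrE ?a0.
Qed.

Lemma kind_norm_ge_pt e a k : nneg a -> kind_mem e a -> a k <= kind_norm e a.
Proof.
move=> a0 am; apply: (kind_le_pt _ a0 _ (kind_mem_le a0 am)).
exact: kind_norm_ge0.
Qed.

Lemma kind_mem_mono e a b :
  nneg a -> (forall k, a k <= b k) -> kind_mem e b -> kind_mem e a.
Proof.
move=> a0 ab; case: e => [b0 eps /b0[m bm]|p p1 /=].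
  by exists m => k /bm; apply: le_lt_trans.
apply: le_lt_trans; apply: le_esum => k _; rewrite lee_fin.
have p0 : 0 < p by apply: lt_le_trans p1.
by rewrite ge0_ler_powR ?nnegrE ?(ltW p0)// (le_trans (a0 k)).
Qed.

Lemma kind_le_mono e a b M :
  nneg a -> (forall k, a k <= b k) -> kind_le e b M -> kind_le e a M.
Proof.
move=> a0 ab; case: e => [bM k|p p1 /= bM F]; first exact: le_trans (bM k).
apply: le_trans (bM F); apply: ler_sum => k _.
have p0 : 0 < p by apply: lt_le_trans p1.
by rewrite ge0_ler_powR ?nnegrE ?(ltW p0)// (le_trans (a0 k)).
Qed.

Lemma kind_leZ e a M (c : R) :
  nneg a -> 0 <= M -> 0 <= c -> kind_le e a M ->
  kind_le e (fun k => c * a k) (c * M).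
Proof.
move=> a0 M0 c0; case: e => [aM k|p p1 /= aM F]; first by rewrite ler_wpM2l.
under eq_bigr do rewrite powRM//.
by rewrite -mulr_sumr powRM// ler_wpM2l// powR_ge0.
Qed.

Lemma convex_powR_div (p x y A B : R) : 1 <= p -> 0 <= x -> 0 <= y ->
  0 < A -> 0 < B ->
  (x + y) `^ p <= (A + B) `^ p *
    (A / (A + B) * (x `^ p / A `^ p) + B / (A + B) * (y `^ p / B `^ p)).
Proof.
move=> p1 x0 y0 A0 B0; have p0 : 0 < p by apply: lt_le_trans p1.
have AB0 : 0 < A + B by rewrite addr_gt0.
have t0 : 0 <= A / (A + B) by rewrite divr_ge0// ltW.
have t1 : A / (A + B) <= 1 by rewrite ler_pdivrMr// mul1r lerDl ltW.
have tE : 1 - A / (A + B) = B / (A + B).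
  by rewrite -{1}(divff (lt0r_neq0 AB0)) -mulrBl addrAC subrr add0r.
have xA : 0 <= x / A by rewrite divr_ge0// ltW.
have yB : 0 <= y / B by rewrite divr_ge0// ltW.
have : (A / (A + B) * (x / A) + B / (A + B) * (y / B)) `^ p <=
    A / (A + B) * (x / A) `^ p + B / (A + B) * (y / B) `^ p.
  rewrite -tE; apply: (convex_powR p1 (Itv01 t0 t1)) => /=;
    by rewrite inE/= in_itv/= ?xA ?yB.
have -> : A / (A + B) * (x / A) + B / (A + B) * (y / B) = (x + y) / (A + B).
  by field; rewrite !gt_eqF.
have dE u v : 0 <= u -> 0 < v -> (u / v) `^ p = u `^ p / v `^ p.
  move=> u0 v0; rewrite powRM ?invr_ge0 ?(ltW v0)//.
  by rewrite -[v^-1]powR_inv1 ?(ltW v0)// -powRrM mulN1r powRN.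
rewrite !dE ?addr_ge0//.
by rewrite ler_pdivrMr ?powR_gt0// mulrC.
Qed.

Lemma kind_leD e a b M N : nneg a -> nneg b -> 0 < M -> 0 < N ->
  kind_le e a M -> kind_le e b N -> kind_le e (fun k => a k + b k) (M + N).
Proof.
move=> a0 b0 M0 N0; case: e => [aM bN k|p p1 /= aM bN F]; first exact: lerD.
have MN0 : 0 < M + N by rewrite addr_gt0.
have := ler_sum F (P := predT)
  (fun k _ => convex_powR_div p1 (a0 k) (b0 k) M0 N0).
move=> /le_trans; apply; rewrite -mulr_sumr big_split/= -!mulr_sumr -!mulr_suml.
rewrite -[leRHS]mulr1 ler_wpM2l ?powR_ge0//.
rewrite -[leRHS](divff (lt0r_neq0 MN0)) mulrDl.
have r1 (c : int -> R) L : 0 < L ->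
    \sum_(k <- F) c k `^ p <= L `^ p ->
    L / (M + N) * ((\sum_(k <- F) c k `^ p) / L `^ p) <= L / (M + N).
  move=> L0 cL; rewrite -[leRHS]mulr1.
  rewrite ler_wpM2l ?divr_ge0 ?(ltW L0) ?(ltW MN0)//.
  by rewrite ler_pdivrMr ?powR_gt0// mul1r.
by apply: lerD; exact: r1.
Qed.

Lemma kind_lp_memP (p : R) (p1 : 1 <= p) a : nneg a ->
  (exists2 M, 0 < M & kind_le (kind_lp p1) a M) -> kind_mem (kind_lp p1) a.
Proof.
by move=> a0 [M M0 /esum_leP aM] /=; apply: le_lt_trans aM _; rewrite ltry.
Qed.

Lemma kind_le_norm1 e a : nneg a -> kind_mem e a ->
  forall eps, 0 < eps -> kind_le e a (kind_norm e a + eps).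
Proof.
move=> a0 am eps eps0; have := kind_mem_le a0 am.
case: e am => [|p p1] am /= h => [k|F].
  by rewrite (le_trans (h k))// lerDl ltW.
apply: le_trans (h F) _.
have n0 : 0 <= kind_norm (kind_lp p1) a by apply: kind_norm_ge0.
rewrite ge0_ler_powR ?nnegrE ?lerDl ?(ltW eps0) ?addr_ge0 ?(ltW eps0)//.
by rewrite (le_trans _ p1).
Qed.

Lemma kind_normD_gt0 e a eps : nneg a -> kind_mem e a -> 0 < eps ->
  0 < kind_norm e a + eps.
Proof. by move=> a0 am eps0; rewrite ltr_wpDl// kind_norm_ge0. Qed.

Lemma kind_mem0 e : kind_mem e (fun=> 0).
Proof.
case: e => [eps eps0|p p1 /=]; first by exists 0%N.
have p0 : 0 < p by apply: lt_le_trans p1.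
by rewrite esum1// => k _; rewrite powR0// gt_eqF.
Qed.

Lemma kind_memD e a b : nneg a -> nneg b -> kind_mem e a -> kind_mem e b ->
  kind_mem e (fun k => a k + b k).
Proof.
move=> a0 b0; case: e => [am bm eps eps0|p p1 am bm].
  have e2 : 0 < eps / 2 by rewrite divr_gt0.
  have [[m Hm] [n Hn]] := (am _ e2, bm _ e2).
  exists (maxn m n) => k; rewrite geq_max => /andP[/Hm ak /Hn bk].
  by rewrite [eps]splitr ltrD.
apply: kind_lp_memP => [k|]; first by rewrite addr_ge0.
exists (kind_norm (kind_lp p1) a + 1 + (kind_norm (kind_lp p1) b + 1)).
  by apply: addr_gt0; exact: kind_normD_gt0.
by apply: kind_leD => //; [exact: kind_normD_gt0..|exact: kind_le_norm1|
  exact: kind_le_norm1].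
Qed.

Lemma kind_memZ e a (c : R) : nneg a -> 0 <= c -> kind_mem e a ->
  kind_mem e (fun k => c * a k).
Proof.
move=> a0 c0; case: e => [am eps eps0|p p1 am].
  have c1 : 0 < c + 1 by rewrite ltr_wpDl.
  have /am[m Hm] : 0 < eps / (c + 1) by rewrite divr_gt0.
  exists m => k /Hm; rewrite ltr_pdivlMr// => /(le_lt_trans _); apply.
  by rewrite mulrC ler_wpM2l// lerDl.
apply: kind_lp_memP => [k|]; first by rewrite mulr_ge0.
exists ((c + 1) * (kind_norm (kind_lp p1) a + 1)).
  by rewrite mulr_gt0 ?kind_normD_gt0// ltr_wpDl.
apply: (@kind_le_mono _ _ (fun k => (c + 1) * a k)) => [k|k|].
- by rewrite mulr_ge0.
- by rewrite ler_wpM2r// lerDl.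
apply: kind_leZ; rewrite ?(ltW (kind_normD_gt0 _ _ _)) ?addr_ge0//.
exact: kind_le_norm1.
Qed.

Lemma kind_normD e a b : nneg a -> nneg b -> kind_mem e a -> kind_mem e b ->
  kind_norm e (fun k => a k + b k) <= kind_norm e a + kind_norm e b.
Proof.
move=> a0 b0 am bm; apply/ler_addgt0Pr => eps eps0.
have e2 : 0 < eps / 2 by rewrite divr_gt0.
rewrite [eps]splitr addrACA; apply: kind_norm_le => [k||].
- by rewrite addr_ge0.
- by rewrite !addr_ge0 ?kind_norm_ge0// ltW.
by apply: kind_leD => //; [exact: kind_normD_gt0..|exact: kind_le_norm1|
  exact: kind_le_norm1].
Qed.

Lemma kind_normZ_le e a (c : R) : nneg a -> 0 <= c -> kind_mem e a ->
  kind_norm e (fun k => c * a k) <= c * kind_norm e a.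
Proof.
move=> a0 c0 am; apply: kind_norm_le => [k||].
- by rewrite mulr_ge0.
- by rewrite mulr_ge0// kind_norm_ge0.
by apply: kind_leZ => //; [exact: kind_norm_ge0|exact: kind_mem_le].
Qed.

Lemma kind_normZ e a (c : R) : nneg a -> 0 <= c -> kind_mem e a ->
  kind_norm e (fun k => c * a k) = c * kind_norm e a.
Proof.
move=> a0 c0 am; apply/eqP; rewrite eq_le kind_normZ_le//=.
have [->|cN0] := eqVneq c 0.
  rewrite mul0r kind_norm_ge0// => [k|]; first by rewrite mul0r.
  by apply: kind_memZ.
have cgt0 : 0 < c by rewrite lt_neqAle eq_sym cN0.
rewrite -ler_pdivlMl//.
have {1}-> : a = (fun k => c^-1 * (c * a k)).
  by apply/funext => k; rewrite mulrA mulVf// mul1r.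
apply: kind_normZ_le; rewrite ?invr_ge0//; last exact: kind_memZ.
by move=> k; rewrite mulr_ge0.
Qed.

Lemma kind_mem_shift e a :
  nneg a -> kind_mem e a -> kind_mem e (fun k => a (k + 1)).
Proof.
move=> a0; case: e => [am eps /am[m Hm]|p p1 /=].
  by exists m.+1 => k mk; apply: Hm; lia.
apply: le_lt_trans; apply: ge_ereal_sup => _ [X [finX _]] <-.
apply: esum_ge; exists [set k + 1 | k in X].
  split; [exact: finite_image|exact: subsetT].
have bij : set_bij X [set k + 1 | k in X] (fun k => k + 1).
  by apply: inj_bij => k l _ _; exact: addIr.
by rewrite (reindex_fsbig _ _ _ _ bij).
Qed.

End SeqKind.

Section SeqSpace.
Variables (R : realType) (s : scalars).
Local Notation K := (scalar_field R s).
Variables (X : int -> completeNormedModType K) (e : seq_kind R).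

(* c_0((X_k)_k, Z) or l^p((X_k)_k, Z), depending on [e]. *)
Record seq_space := SeqSpace {
  seq_val :> forall k : int, X k;
  seq_valP : kind_mem e (fun k => rnorm (seq_val k))
}.

Lemma seq_space_eq (x y : seq_space) : (forall k, x k = y k) -> x = y.
Proof.
case: x y => [x xP] [y yP] /= xy.
have {}xy : x = y by apply: functional_extensionality_dep.
by case: _ / xy yP => yP; congr SeqSpace; apply: Prop_irrelevance.
Qed.

Let rnorm_seq_ge0 (x : forall k, X k) k : 0 <= rnorm (x k).
Proof. exact: rnorm_ge0. Qed.

Lemma seq_zeroP : kind_mem e (fun k => rnorm (0 : X k)).
Proof.
apply: (kind_mem_mono (fun k => rnorm_ge0 _) _ (kind_mem0 e)) => k.
by rewrite rnorm0.
Qed.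

Lemma seq_addP (x y : seq_space) : kind_mem e (fun k => rnorm (x k + y k)).
Proof.
apply: (kind_mem_mono (fun k => rnorm_ge0 _) (fun k => ler_rnormD _ _)).
exact: kind_memD (rnorm_seq_ge0 x) (rnorm_seq_ge0 y) (seq_valP x) (seq_valP y).
Qed.

Lemma seq_scaleP (a : K) (x : seq_space) :
  kind_mem e (fun k => rnorm (a *: x k)).
Proof.
have a0 : 0 <= to_real `|a| by exact: (rnorm_ge0 (a : K^o)).
apply: (kind_mem_mono (fun k => rnorm_ge0 _) _
  (kind_memZ (rnorm_seq_ge0 x) a0 (seq_valP x))) => k.
by rewrite rnormZ.
Qed.

Lemma seq_oppP (x : seq_space) : kind_mem e (fun k => rnorm (- x k)).
Proof.
apply: (kind_mem_mono (fun k => rnorm_ge0 _) _ (seq_scaleP (- 1) x)) => k.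
by rewrite scaleN1r.
Qed.

Definition seq_zero := SeqSpace seq_zeroP.
Definition seq_opp x := SeqSpace (seq_oppP x).
Definition seq_add x y := SeqSpace (seq_addP x y).
Definition seq_scale a x := SeqSpace (seq_scaleP a x).

HB.instance Definition _ := gen_eqMixin seq_space.
HB.instance Definition _ := gen_choiceMixin seq_space.

Let seq_addA : associative seq_add.
Proof. by move=> x y z; apply: seq_space_eq => k /=; rewrite addrA. Qed.

Let seq_addC : commutative seq_add.
Proof. by move=> x y; apply: seq_space_eq => k /=; rewrite addrC. Qed.

Let seq_add0 : left_id seq_zero seq_add.
Proof. by move=> x; apply: seq_space_eq => k /=; rewrite add0r. Qed.

Let seq_addN : left_inverse seq_zero seq_opp seq_add.
Proof. by move=> x; apply: seq_space_eq => k /=; rewrite addNr. Qed.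

HB.instance Definition _ :=
  GRing.isZmodule.Build seq_space seq_addA seq_addC seq_add0 seq_addN.

Let seq_scaleA a b x : seq_scale a (seq_scale b x) = seq_scale (a * b) x.
Proof. by apply: seq_space_eq => k /=; rewrite scalerA. Qed.

Let seq_scale1 : left_id 1 seq_scale.
Proof. by move=> x; apply: seq_space_eq => k /=; rewrite scale1r. Qed.

Let seq_scaleDr : right_distributive seq_scale +%R.
Proof. by move=> a x y; apply: seq_space_eq => k /=; rewrite scalerDr. Qed.

Let seq_scaleDl x : {morph seq_scale^~ x : a b / a + b}.
Proof. by move=> a b; apply: seq_space_eq => k /=; rewrite scalerDl. Qed.

HB.instance Definition _ := GRing.Zmodule_isLmodule.Build K seq_space
  seq_scaleA seq_scale1 seq_scaleDr seq_scaleDl.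

Definition seq_norm (x : seq_space) : K :=
  of_real s (kind_norm e (fun k => rnorm (x k))).

Let seq_normD x y : seq_norm (x + y) <= seq_norm x + seq_norm y.
Proof.
rewrite /seq_norm -of_realD ler_of_real.
have [x0 y0] := (rnorm_seq_ge0 x, rnorm_seq_ge0 y).
have [xm ym] := (seq_valP x, seq_valP y).
have xym := kind_memD x0 y0 xm ym.
have xy0 k : 0 <= rnorm (x k) + rnorm (y k) by exact: addr_ge0.
apply: le_trans (kind_normD x0 y0 xm ym).
apply: kind_norm_le (rnorm_seq_ge0 _) (kind_norm_ge0 xy0 xym) _.
apply: kind_le_mono (rnorm_seq_ge0 _) _ (kind_mem_le xy0 xym) => k.
exact: ler_rnormD.
Qed.

Let seq_normZ a x : seq_norm (a *: x) = `|a| * seq_norm x.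
Proof.
rewrite /seq_norm -(to_realK (normr_ge0 a)) -of_realM.
rewrite -(kind_normZ (rnorm_seq_ge0 x) _ (seq_valP x)).
  by congr (of_real s (kind_norm e _)); apply/funext => k; rewrite rnormZ.
exact: (rnorm_ge0 (a : K^o)).
Qed.

Let seq_norm_eq0 x : seq_norm x = 0 -> x = 0.
Proof.
rewrite /seq_norm -(of_real0 R s) => /of_real_inj x0.
apply: seq_space_eq => k; apply: rnorm_eq0; apply/eqP.
rewrite eq_le rnorm_ge0 andbT -x0.
exact: kind_norm_ge_pt (rnorm_seq_ge0 x) (seq_valP x).
Qed.

HB.instance Definition _ := Lmodule_isNormed.Build K seq_space
  seq_normD seq_normZ seq_norm_eq0.

End SeqSpace.

Section Shift.
Variables (R : realType) (s : scalars).
Local Notation K := (scalar_field R s).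
Variable X : int -> completeNormedModType K.
Variable T : forall k : int, {linear X k -> X (k - 1)}.

(* Transport along an equality of indices: X_{(k+1)-1} and X_k, for instance,
   are not convertible. *)
Definition cast_index (i j : int) (ij : i = j) (x : X i) : X j :=
  ecast k (X k) ij x.

Lemma rnorm_cast_index i j (ij : i = j) (x : X i) :
  rnorm (cast_index ij x) = rnorm x.
Proof. by case: _ / ij. Qed.

Definition shift_seq (x : forall k, X k) : forall k, X k :=
  fun k => cast_index (addrK 1 k) (T (k + 1) (x (k + 1))).

Definition uniformly_bounded : Prop :=
  (ereal_sup [set op_norm (T k) | k in [set: int]] < +oo)%E.

Lemma shift_seqP (e : seq_kind R) (T_bnd : uniformly_bounded)
    (x : seq_space X e) : kind_mem e (fun k => rnorm (shift_seq x k)).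
Proof.
have Tle k : (op_norm (T k) <= ereal_sup [set op_norm (T k) | k in setT])%E.
  by apply: ereal_sup_ubound; exists k.
have [M M0 TM] : exists2 M : R, 0 <= M & forall k, (op_norm (T k) <= M%:E)%E.
  move: T_bnd Tle; rewrite /uniformly_bounded.
  case: ereal_sup => [M _ TM|oo _|_ TM]; [|by rewrite ltxx in oo|].
    by exists `|M| => // k; rewrite (le_trans (TM k))// lee_fin ler_norm.
  by exists 0 => // k; rewrite (le_trans (TM k))// leNye.
have x0 k : 0 <= rnorm (x (k + 1)) by exact: rnorm_ge0.
apply: (kind_mem_mono (fun k => rnorm_ge0 _) _ (kind_memZ x0 M0 _)) => [k|].
  by rewrite rnorm_cast_index; exact: rnorm_op_norm.
exact: kind_mem_shift (fun k => rnorm_ge0 (x k)) (seq_valP x).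
Qed.

Definition op_shift (e : seq_kind R) (T_bnd : uniformly_bounded)
  (x : seq_space X e) : seq_space X e := SeqSpace (shift_seqP T_bnd x).

Lemma T_down_index (n : int) (m : nat) : n - m%:Z - 1 = n - m.+1%:Z.
Proof. lia. Qed.

Fixpoint T_down (n : int) (m : nat) : X n -> X (n - m%:Z) :=
  match m return X n -> X (n - m%:Z) with
  | 0%N => cast_index (esym (subr0 n))
  | m'.+1 =>
      fun x => cast_index (T_down_index n m') (T (n - m'%:Z) (T_down m' x))
  end.

(* T_{k,n} = T_{k+1} o ... o T_n for k = n - m, [m] being the number of
   factors. *)
Definition T_comp (k n : int) (m : nat) (nmk : n - m%:Z = k) : X n -> X k :=
  fun x => cast_index nmk (T_down m x).

Definition shift_condition : Prop :=
  forall N : nat, (1 <= N)%N ->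
  forall U V : forall j : int, set (X j),
    (forall j : int, - N%:Z <= j <= N%:Z ->
       [/\ open (U j), U j !=set0, open (V j) & V j !=set0]) ->
  exists2 n : nat, (0 < n)%N &
    forall j : int, - N%:Z <= j <= N%:Z ->
      (T_comp (erefl (j - n%:Z)) @` U j `&` ball (0 : X (j - n%:Z)) 1) !=set0
      /\
      (T_comp (addrK n%:Z j) @` ball (0 : X (j + n%:Z)) 1 `&` V j) !=set0.

End Shift.

Definition separable_space (T : topologicalType) : Prop :=
  exists2 D : set T, countable D & dense D.

Definition hypercyclic (Y : topologicalType) (S : Y -> Y) : Prop :=
  exists y : Y, dense [set iter n S y | n in [set: nat]].

Definition op_direct_sum (Y Z : Type) (S : Y -> Y) (S' : Z -> Z) :
  Y * Z -> Y * Z :=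
  fun yz => (S yz.1, S' yz.2).

Definition weakly_mixing (Y : topologicalType) (S : Y -> Y) : Prop :=
  hypercyclic (op_direct_sum S S).

(* Main.v *)
(* (1) => (3): in a nonzero space a hypercyclic operator maps a point near u to
   a point near v by arbitrarily large powers n; test this on u and v supported
   in [-N, N] with n > 2N, so that u_{j+n} = v_{j-n} = 0.
   (3) => (2): summing over [-N, N], rescaled instances of (3) give the blow-up
   and collapse property: for open A, C and every neighbourhood W of 0, some
   B^n maps a point of A into W and a point of W into C.  With k and l chosen
   such that B^k meets (A_1, A_2) and B^l meets (C_1, C_2), that property for
   A_1 \cap B^-k A_2 and C_1 \cap B^-l C_2 yields u and w such that
   (u + w, B^k u + B^l w) is sent by (B (+) B)^n from A_1 x A_2 to C_1 x C_2.
   Birkhoff's transitivity theorem concludes. *)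

Require Import Defs.
From mathcomp Require Import all_boot all_order all_algebra.
From mathcomp Require Import finmap.
From mathcomp Require Import all_classical all_reals all_analysis.
From mathcomp Require Import lra zify.

Set Implicit Arguments.
Unset Strict Implicit.
Unset Printing Implicit Defensive.

Import Order.TTheory GRing.Theory Num.Theory.
Import numFieldNormedType.Exports.

Local Open Scope classical_set_scope.
Local Open Scope ring_scope.

(** * Topology of a normed space in terms of its real-valued norm *)

Section RealNorm.
Variables (R : realType) (s : scalars).
Local Notation K := (scalar_field R s).

Lemma ltr_of_real (x y : R) : (of_real s x < of_real s y) = (x < y).
Proof. by rewrite !lt_def ler_of_real (inj_eq (@of_real_inj R s)). Qed.

Variable V : normedModType K.
Implicit Types (x y : V) (A : set V).

Lemma rnormN x : rnorm (- x) = rnorm x.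
Proof. by rewrite /rnorm normrN. Qed.

Lemma rdistC x y : rnorm (x - y) = rnorm (y - x).
Proof. by rewrite -rnormN opprB. Qed.

Lemma ler_rdistD x y z : rnorm (x - z) <= rnorm (x - y) + rnorm (y - z).
Proof. by rewrite -{1}(subrK y x) -addrA ler_rnormD. Qed.

Lemma ler_rnorm_sum (I : eqType) (l : seq I) (F : I -> V) (d : R) :
  (forall i, i \in l -> rnorm (F i) <= d) ->
  rnorm (\sum_(i <- l) F i) <= (size l)%:R * d.
Proof.
elim: l => [|i l IH] Fd; first by rewrite big_nil rnorm0 mul0r.
rewrite big_cons -natr1 mulrDl mul1r addrC.
apply: le_trans (ler_rnormD _ _) (lerD _ _).
  by apply: IH => j jl; apply: Fd; rewrite inE jl orbT.
by apply: Fd; rewrite mem_head.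
Qed.

Lemma rnorm_of_realZ (a : R) x :
  0 <= a -> rnorm (of_real s a *: x) = a * rnorm x.
Proof.
move=> a0; rewrite rnormZ ger0_norm ?of_realK//.
by rewrite -(of_real0 R s) ler_of_real.
Qed.

(** Library balls have their radius in [K], but a positive element of [K] is real even in the
    complex case, so [to_real] and [of_real] translate between the two kinds of radii. *)
Lemma nbhs_rnormP x A :
  nbhs x A <-> exists2 r : R, 0 < r & forall y, rnorm (y - x) < r -> A y.
Proof.
split=> [/nbhs_ballP[e /= e0 eA]|[r r0 rA]].
  have eE : of_real s (to_real e) = e by rewrite to_realK// ltW.
  exists (to_real e) => [|y yx]; first by rewrite -(ltr_of_real) eE of_real0.
  apply: eA; rewrite -ball_normE /= distrC -of_real_rnorm -eE.
  by rewrite ltr_of_real.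
apply/nbhs_ballP; exists (of_real s r) => /=.
  by rewrite -(of_real0 R s) ltr_of_real.
move=> y; rewrite -ball_normE /= distrC -of_real_rnorm ltr_of_real.
exact: rA.
Qed.

Lemma open_rnorm A x : open A -> A x ->
  exists2 r : R, 0 < r & forall y, rnorm (y - x) < r -> A y.
Proof. by move=> Ao Ax; apply/nbhs_rnormP; exact: open_nbhs_nbhs. Qed.

Lemma rnorm_open A :
  (forall x, A x ->
     exists2 r : R, 0 < r & forall y, rnorm (y - x) < r -> A y) ->
  open A.
Proof.
by move=> AP; rewrite openE => x /AP; rewrite /interior /= => /nbhs_rnormP.
Qed.

Lemma open_rball x (r : R) : open [set y | rnorm (y - x) < r].
Proof.
apply: rnorm_open => y /= yr; exists (r - rnorm (y - x)).
  by rewrite subr_gt0.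
by move=> z; rewrite ltrBrDr; apply: le_lt_trans; exact: ler_rdistD.
Qed.

Lemma ball0E x (r : R) : ball (0 : V) (of_real s r) x <-> rnorm x < r.
Proof. by rewrite -ball_normE /= sub0r normrN -of_real_rnorm ltr_of_real. Qed.

Lemma open_setD1 A a : open A -> open (A `&` [set~ a]).
Proof.
move=> Ao; apply: rnorm_open => x [Ax xa].
have [r r0 rA] := open_rnorm Ao Ax.
have d0 : 0 < rnorm (x - a).
  rewrite lt_neqAle rnorm_ge0 andbT eq_sym; apply/eqP => /rnorm_eq0 /eqP.
  by rewrite subr_eq0 => /eqP.
exists (Num.min r (rnorm (x - a))); first by rewrite lt_min r0.
move=> y; rewrite lt_min => /andP[/rA Ay yx]; split=> // ya.
by move: yx; rewrite ya rdistC ltxx.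
Qed.

(** A nonzero space has no isolated point: if the given point of [A] is [a] itself, a small multiple
    of [w] moves it off [a] without leaving [A]. *)
Lemma setD1_nonempty A (a w : V) : w != 0 -> open A -> A !=set0 ->
  (A `&` [set~ a]) !=set0.
Proof.
move=> w0 Ao [x Ax]; have [xa|xa] := eqVneq x a; last first.
  by exists x; split=> //; apply/eqP.
have [r r0 rA] := open_rnorm Ao Ax.
have wn0 : 0 < rnorm w.
  by rewrite lt_neqAle rnorm_ge0 andbT eq_sym; apply: contra_neq w0 => /rnorm_eq0.
pose t := r / 2 / rnorm w.
have t0 : 0 < t by rewrite !divr_gt0.
exists (x + of_real s t *: w); split.
  apply: rA; rewrite addrC addKr rnorm_of_realZ ?ltW// /t mulfVK ?gt_eqF//.
  by rewrite ltr_pdivrMr// mulr_natr mulr2n ltrDl.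
move=> /= /eqP; rewrite -xa -subr_eq0 addrC addKr scaler_eq0 (negbTE w0) orbF.
by rewrite -(of_real0 R s) (inj_eq (@of_real_inj R s)) gt_eqF.
Qed.

(** Serves to discard an initial segment of an orbit from an open set. *)
Lemma setDseq (l : seq V) A (w : V) : w != 0 -> open A -> A !=set0 ->
  open (A `\` [set` l]) /\ (A `\` [set` l]) !=set0.
Proof.
move=> w0; elim: l A => [|a l IH] A Ao A0.
  by rewrite set_nil setD0.
have -> : A `\` [set` a :: l] = (A `&` [set~ a]) `\` [set` l].
  apply/seteqP; split=> x /=; rewrite inE.
    by move=> [Ax /negP]; rewrite negb_or => /andP[/eqP xa /negP].
  by move=> [[Ax xa] xl]; split=> //; apply/negP/norP; split; [exact/eqP|exact/negP].
apply: IH; [exact: open_setD1|exact: setD1_nonempty w0 Ao A0].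
Qed.

End RealNorm.

(** * Hypercyclicity, topological transitivity and Birkhoff's theorem *)

Section Transitivity.
Variables (R : realType) (s : scalars).
Local Notation K := (scalar_field R s).

Lemma continuous_rnormP (V W : normedModType K) (f : V -> W) :
  continuous f <-> forall x (eps : R), 0 < eps -> exists2 d : R, 0 < d &
    forall y, rnorm (y - x) < d -> rnorm (f y - f x) < eps.
Proof.
split=> [fc x eps eps0|fP x A].
  apply/(nbhs_rnormP x [set y | rnorm (f y - f x) < eps]).
  have /fc : nbhs (f x) [set y | rnorm (y - f x) < eps].
    by apply/nbhs_rnormP; exists eps.
  exact.
move=> /(nbhs_rnormP (f x) A)[r r0 rA]; have [d d0 dP] := fP x r r0.
by apply/(nbhs_rnormP x (f @^-1` A)); exists d => // y /dP /rA.
Qed.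

Lemma continuous_iter (Z : topologicalType) (S : Z -> Z) n :
  continuous S -> continuous (iter n S).
Proof.
move=> Sc; elim: n => [|n IH] x; first exact: cvg_id.
by apply: (@continuous_comp _ _ _ (iter n S) S); [exact: IH|exact: Sc].
Qed.

Definition topologically_transitive (Z : topologicalType) (S : Z -> Z) : Prop :=
  forall A B : set Z, open A -> A !=set0 -> open B -> B !=set0 ->
  exists n z, A z /\ B (iter n S z).

(** Once the orbit of [y] is in [A] at time [k], its points at times up to [k + m] are deleted from
    [B]. The orbit meets the rest at some time [n], necessarily beyond [k + m], and [n - k] is the
    required power. *)
Lemma hypercyclic_transitive (V : normedModType K) (w : V) (S : V -> V) :
  w != 0 -> hypercyclic S -> forall (m : nat) (A B : set V),
  open A -> A !=set0 -> open B -> B !=set0 ->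
  exists2 n, (m < n)%N & exists2 z, A z & B (iter n S z).
Proof.
move=> w0 [y yd] m A B Ao A0 Bo B0.
have [a [Aa [k _ ky]]] := yd A A0 Ao.
pose l := [seq iter i S y | i <- iota 0 (k + m).+1].
have [B'o B'0] := setDseq l w0 Bo B0.
have [b [[Bb nl] [n _ ny]]] := yd _ B'0 B'o.
have nkm : (k + m < n)%N.
  rewrite ltnNge; apply/negP => nkm; apply: nl => /=.
  by rewrite -ny; apply/mapP; exists n => //; rewrite mem_iota add0n ltnS.
exists (n - k)%N; first by lia.
exists (iter k S y); first by rewrite ky.
by rewrite -iterD subnK ?ny//; lia.
Qed.

(** Completeness is a predicate because [seq_space] is built as a normed space only. The explicit
    error bound [r] is inherited by coordinates and survives in the limit. *)
Definition seq_complete (V : normedModType K) : Prop :=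
  forall (u : nat -> V) (r : nat -> R),
  (forall n m, (n <= m)%N -> rnorm (u m - u n) <= r n) ->
  (forall eps, 0 < eps -> exists N, forall n, (N <= n)%N -> r n < eps) ->
  exists l, forall n, rnorm (l - u n) <= r n.

Lemma rdist_limit (V : normedModType K) (u : nat -> V) (r : nat -> R) l :
  (forall n m, (n <= m)%N -> rnorm (u m - u n) <= r n) ->
  (forall eps, 0 < eps ->
     exists N, forall n, (N <= n)%N -> rnorm (l - u n) < eps) ->
  forall n, rnorm (l - u n) <= r n.
Proof.
move=> ur ul n; apply/ler_addgt0Pr => eps /ul[N Neps].
rewrite (le_trans (ler_rdistD _ (u (maxn n N)) _))// addrC.
by rewrite lerD ?ur ?leq_maxl// ltW// Neps ?leq_maxr.
Qed.

Lemma complete_seq_complete (V : completeNormedModType K) : seq_complete V.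
Proof.
move=> u r ur r0.
have cu : cauchy (u @ \oo).
  apply: cauchy_exP => e e0.
  have eE : of_real s (to_real e) = e by rewrite to_realK// ltW.
  have e0' : 0 < to_real e by rewrite -(@ltr_of_real R s) eE of_real0.
  have [N Nr] := r0 _ e0'; exists (u N).
  exists N => //= m /= Nm; rewrite -ball_normE /= distrC.
  rewrite -of_real_rnorm -eE ltr_of_real.
  by apply: le_lt_trans (ur _ _ Nm) (Nr _ _).
exists (lim (u @ \oo)); apply: rdist_limit ur _ => eps eps0.
have /cauchy_cvg ul := cu.
have : nbhs (lim (u @ \oo)) [set y | rnorm (y - lim (u @ \oo)) < eps].
  by apply/nbhs_rnormP; exists eps.
by move=> /ul [N _ NP]; exists N => n /NP /=; rewrite rdistC.
Qed.

(** The product norm is a maximum in [K], whose order is partial in the complex case; norms are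
    real, hence comparable. *)
Lemma rnorm_pair_le (V W : normedModType K) (z : V * W) (r : R) :
  (rnorm z <= r) = (rnorm z.1 <= r) && (rnorm z.2 <= r).
Proof.
rewrite -!(@ler_of_real R s) !of_real_rnorm.
by rewrite prod_normE/= comparable_ge_max// real_comparable ?normr_real.
Qed.

Lemma rnorm_pair_lt (V W : normedModType K) (z : V * W) (r : R) :
  (rnorm z < r) = (rnorm z.1 < r) && (rnorm z.2 < r).
Proof.
rewrite -!(@ltr_of_real R s) !of_real_rnorm.
by rewrite prod_normE/= comparable_gt_max// real_comparable ?normr_real.
Qed.

Lemma prod_seq_complete (V W : normedModType K) :
  seq_complete V -> seq_complete W -> seq_complete (V * W)%type.
Proof.
move=> Vc Wc u r ur r0.
have [|l1 l1P] := Vc (fun n => (u n).1) r _ r0.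
  by move=> n m /ur; rewrite rnorm_pair_le => /andP[].
have [|l2 l2P] := Wc (fun n => (u n).2) r _ r0.
  by move=> n m /ur; rewrite rnorm_pair_le => /andP[].
by exists (l1, l2) => n; rewrite rnorm_pair_le l1P l2P.
Qed.


Lemma open_iter_preimage (Z : topologicalType) (S : Z -> Z) n (B : set Z) :
  continuous S -> open B -> open (iter n S @^-1` B).
Proof.
by move=> Sc Bo; apply: open_comp => // z _; exact: continuous_iter.
Qed.

(** A Baire category argument done by hand. Every non-empty open set contains some [G i]; closed
    balls are nested so that a power of [S] sends the ball of index [i.+1] into [G i]. The centres
    converge to a point of all the balls, whose orbit is therefore dense. *)
Lemma birkhoff (V : normedModType K) (S : V -> V) :
  seq_complete V -> separable_space V -> continuous S ->
  topologically_transitive S -> hypercyclic S.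
Proof.
move=> Vc [D Dc Dd] Sc St.
have [f finj] := countable_injP D Dc.
(* [g] inverts [f] on [D], with default value 0 at the integers that [f] does not reach. *)
have /choice[g gP] : forall a : nat, exists v, forall d, D d -> f d = a -> v = d.
  move=> a; have [[d Dd' fd]|nd] := pselect (exists2 d, D d & f d = a).
    by exists d => d' Dd'' fd'; apply: finj; rewrite ?inE// fd.
  by exists 0 => d Dd' fd; case: nd; exists d.
pose rad (m : nat) : R := m.+1%:R^-1.
have rad0 m : 0 < rad m by rewrite invr_gt0.
have radP eps : 0 < eps -> exists N, forall n, (N <= n)%N -> rad n < eps.
  move=> eps0; have := near_infty_natSinv_lt (PosNum eps0).
  by move=> [N _ NP]; exists N => n /NP.
(* An index codes a centre and a radius; one that codes nothing stands for the whole space. *)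
pose G (i : nat) : set V := if choice.unpickle i is Some (a, m)
  then [set z | rnorm (z - g a) < rad m] else setT.
have Go i : open (G i).
  by rewrite /G; case: (choice.unpickle i) => [[a m]|]; [exact: open_rball|exact: openT].
have G0 i : G i !=set0.
  rewrite /G; case: (choice.unpickle i) => [[a m]|]; last by exists 0.
  by exists (g a) => /=; rewrite subrr rnorm0.
have GP B : open B -> B !=set0 -> exists i, G i `<=` B.
  move=> Bo B0; have [d [Bd Dd']] := Dd B B0 Bo.
  have [r r0 rB] := open_rnorm Bo Bd.
  have [m mr] := radP r r0; exists (choice.pickle (f d, m)).
  rewrite /G choice.pickleK (gP _ _ Dd' erefl) => z /= zd.
  by apply: rB; apply: lt_trans zd (mr m _).
(* A pair is a centre and a radius. Making positivity of the old radius a premise keeps the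
   statement total, as [choice] demands. The first inequality nests the balls, the second sends the
   radii to 0. *)
have step (p : (V * R) * nat) : exists q : V * R, 0 < p.1.2 ->
    [/\ 0 < q.2, rnorm (q.1 - p.1.1) + q.2 <= p.1.2, q.2 <= rad p.2 &
      exists m, forall z, rnorm (z - q.1) <= q.2 -> G p.2 (iter m S z)].
  move: p => [[x r] i] /=; have [r0|nr0] := pselect (0 < r); last by exists (x, r).
  have B0 : [set y | rnorm (y - x) < r] !=set0.
    by exists x; rewrite /= subrr rnorm0.
  have [n [z [zr zG]]] := St _ _ (open_rball x r) B0 (Go i) (G0 i).
  have [t t0 tG] := open_rnorm (open_iter_preimage n Sc (Go i)) zG.
  (* Half of [t], since a closed ball has to fit into the open ball of radius [t]. *)
  exists (z, Num.min (t / 2) (Num.min (r - rnorm (z - x)) (rad i))) => _ /=.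
  split.
  - by rewrite !lt_min rad0 subr_gt0 zr divr_gt0.
  - by rewrite addrC -lerBrDr 2!ge_min lexx orbT.
  - by rewrite !ge_min lexx !orbT.
  - exists n => y; rewrite le_min => /andP[yt _]; apply: tG.
    by apply: le_lt_trans yt _; rewrite ltr_pdivrMr// mulr_natr mulr2n ltrDl.
have [F FP] := choice step.
pose q := fix q n := if n is n'.+1 then F (q n', n') else (0 : V, 1 : R).
have q0 n : 0 < (q n).2 by elim: n => //= n IH; have [] := FP (q n, n) IH.
have qr n m : (n <= m)%N -> rnorm ((q m).1 - (q n).1) + (q m).2 <= (q n).2.
  elim: m => [|m IH]; first by rewrite leqn0 => /eqP ->; rewrite subrr rnorm0 add0r.
  rewrite leq_eqVlt ltnS => /predU1P[->|/IH nm].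
    by rewrite subrr rnorm0 add0r.
  have [_ qm _ _] := FP (q m, m) (q0 m); apply: le_trans nm.
  have := ler_rdistD (q m.+1).1 (q m).1 (q n).1; move: qm => /=; lra.
have [||y yP] := Vc (fun n => (q n).1) (fun n => (q n).2).
- by move=> n m /qr; apply: le_trans; rewrite lerDl ltW.
- move=> eps /radP[N NP]; exists N.+1 => -[//|n] Nn /=.
  by have [_ _ qn _] := FP (q n, n) (q0 n); apply: le_lt_trans qn (NP _ _).
exists y => B B0 Bo; have [i GB] := GP B Bo B0.
have [_ _ _ [m mP]] := FP (q i, i) (q0 i).
by exists (iter m S y); split; [apply/GB/mP; exact: (yP i.+1)|exists m].
Qed.

Lemma collapse_blowup_transitive (V : normedModType K) (S : V -> V) :
  {morph S : x y / x + y} -> continuous S ->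
  (forall (A B W : set V), open A -> A !=set0 -> open B -> B !=set0 ->
     open W -> W 0 -> exists n x w,
     [/\ A x, W (iter n S x), W w & B (iter n S w)]) ->
  topologically_transitive (op_direct_sum S S).
Proof.
move=> SD Sc SP.
have iterSD n : {morph iter n S : x y / x + y}.
  by elim: n => // n IH x y; rewrite /= IH SD.
have S0 : S 0 = 0 by apply: (@addIr _ (S 0)); rewrite -SD !add0r.
have iterS0 n : iter n S 0 = 0 by elim: n => //= n ->.
have iterSS n z : iter n (op_direct_sum S S) z = (iter n S z.1, iter n S z.2).
  by elim: n => [|n IH] /=; [case: z|rewrite IH].
have rdist_add (p q a : V) (r : R) :
    rnorm (p - a) < r -> rnorm q < r -> rnorm (p + q - a) < r + r.
  by move=> pa qr; rewrite addrAC (le_lt_trans (ler_rnormD _ _))// ltrD.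
have open_ball0 (r : R) : open [set y : V | rnorm y < r].
  by rewrite (_ : mkset _ = [set y | rnorm (y - 0) < r])//;
    [exact: open_rball|apply/funext => y /=; rewrite subr0].
(* Transitivity of [S] itself, which will make the sets [pull] non-empty: add a point near [a] that
   collapses to a small point that is blown up to near [b]. *)
have tr (a b : V) (r : R) : 0 < r ->
    exists k x, rnorm (x - a) < r /\ rnorm (iter k S x - b) < r.
  move=> r0; have r2 : 0 < r / 2 by rewrite divr_gt0.
  have [||| n [x [w [xa Sxd wd Swb]]]] :=
    SP _ _ _ (open_rball a (r / 2)) _ (open_rball b (r / 2)) _ (open_ball0 (r / 2)).
  - by exists a; rewrite /= subrr rnorm0.
  - by exists b; rewrite /= subrr rnorm0.
  - by rewrite /= rnorm0.
  exists n, (x + w); rewrite iterSD [r]splitr.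
  by split; [|rewrite [X in X - b]addrC]; exact: rdist_add.
move=> A B Ao [a Aa] Bo [b Bb].
have [r r0 rA] := open_rnorm Ao Aa; have [t t0 tB] := open_rnorm Bo Bb.
(* Each coordinate of the final witness and of its image is a well-placed vector plus a small one,
   each with error below [d]. *)
pose d := Num.min r t / 2.
have d0 : 0 < d by rewrite divr_gt0// lt_min r0.
have [k [x [xa kxa]]] := tr a.1 a.2 d d0.
have [l [y [yb lyb]]] := tr b.1 b.2 d d0.
pose pull m (p q : V) := [set z | rnorm (z - p) < d] `&`
  iter m S @^-1` [set z | rnorm (z - q) < d].
have pullo m p q : open (pull m p q).
  apply: openI; first exact: open_rball.
  by apply: open_iter_preimage => //; exact: open_rball.
pose W0 := [set z : V | rnorm z < d].
(* The neighbourhood of 0 also controls images under the powers [k] and [l], because the second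
   coordinate of the witness is [iter k S u + iter l S w]. *)
have [||||n [u [w [[ua kua] [Sud [kud lud]] [wd [kwd lwd]] [Swb lSwb]]]]] :=
  SP _ _ (W0 `&` (iter k S @^-1` W0 `&` iter l S @^-1` W0))
    (pullo k a.1 a.2) _ (pullo l b.1 b.2) _ _.
- by exists x.
- by exists y.
- apply: openI; first exact: open_ball0.
  by apply: openI; apply: open_iter_preimage => //; exact: open_ball0.
- by rewrite /W0 /= !iterS0 rnorm0.
have iterC i j z : iter i S (iter j S z) = iter j S (iter i S z).
  by rewrite -!iterD addnC.
have dr : d + d <= r by rewrite -splitr ge_min lexx.
have dt : d + d <= t by rewrite -splitr ge_min lexx orbT.
exists n, (u + w, iter k S u + iter l S w); split.
  apply: rA; apply: lt_le_trans dr; rewrite rnorm_pair_lt.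
  by apply/andP; split; exact: rdist_add.
apply: tB; apply: lt_le_trans dt; rewrite rnorm_pair_lt iterSS /=.
rewrite !iterSD !(iterC n) [X in X - b.1]addrC [X in X - b.2]addrC.
by apply/andP; split; exact: rdist_add.
Qed.

Lemma separable_prod (V W : normedModType K) :
  separable_space V -> separable_space W -> separable_space (V * W)%type.
Proof.
move=> [D Dc Dd] [E Ec Ed]; exists (D `*` E); first exact: countableX.
move=> A [x Ax] Ao; have [r r0 rA] := open_rnorm Ao Ax.
have [|y [yx Dy]] := Dd [set y | rnorm (y - x.1) < r] _ (open_rball _ _).
  by exists x.1; rewrite /= subrr rnorm0.
have [|z [zx Ez]] := Ed [set y | rnorm (y - x.2) < r] _ (open_rball _ _).
  by exists x.2; rewrite /= subrr rnorm0.
by exists (y, z); split=> //; apply: rA; rewrite rnorm_pair_lt; apply/andP.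
Qed.

Lemma continuous_direct_sum (V W : normedModType K) (S : V -> V) (S' : W -> W) :
  continuous S -> continuous S' -> continuous (op_direct_sum S S').
Proof.
move=> Sc S'c; apply/continuous_rnormP => x eps eps0.
have [d d0 dS] := (continuous_rnormP S).1 Sc x.1 eps eps0.
have [d' d'0 dS'] := (continuous_rnormP S').1 S'c x.2 eps eps0.
exists (Num.min d d') => [|y]; first by rewrite lt_min d0.
rewrite !rnorm_pair_lt !lt_min => /andP[/andP[y1 _] /andP[_ y2]].
by apply/andP; split; [exact: dS|exact: dS'].
Qed.

(** The first coordinate of a vector with dense orbit works: test that orbit on the cylinder over
    [A]. *)
Lemma weakly_mixing_hypercyclic (V : normedModType K) (S : V -> V) :
  weakly_mixing S -> hypercyclic S.
Proof.
move=> [y yd]; exists y.1 => A [x Ax] Ao.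
have [||z [Az [n _ nz]]] := yd (fst @^-1` A).
- by exists (x, x).
- by apply: open_comp => // z _; exact: cvg_fst.
exists z.1; split=> //; exists n => //; rewrite -nz.
by elim: n {nz} => //= n ->.
Qed.

End Transitivity.

(** * Scalar sequences in c_0 and l^p: local bounds, approximation and tails *)

Section Kind.
Variable R : realType.
Implicit Types (e : seq_kind R) (a : int -> R).

Lemma kind_le_uniq (p : R) (p1 : 1 <= p) a (M : R) (l : seq int) :
  kind_le (kind_lp p1) a M -> uniq l -> \sum_(k <- l) a k `^ p <= M `^ p.
Proof.
move=> aM ul; apply: le_trans (aM [fset k in l]%fset).
rewrite le_eqVlt; apply/orP; left; apply/eqP.
by apply: perm_big; apply: uniq_perm; rewrite ?fset_uniq// => k; rewrite !inE.
Qed.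

Lemma kind_le_weaken e a (M M' : R) :
  0 <= M -> M <= M' -> kind_le e a M -> kind_le e a M'.
Proof.
move=> M0 MM'; case: e => [aM k|p p1 aM F]; first exact: le_trans (aM k) MM'.
apply: le_trans (aM F) _.
have p0 : 0 <= p := le_trans ler01 p1.
by rewrite ge0_ler_powR ?nnegrE// (le_trans M0).
Qed.

(** [kind_le] inspects finitely many coordinates at a time, a single one for c_0 and a finite sum
    for l^p, so the comparison sequence [b] may depend on the finite set. *)
Lemma kind_le_local e a M :
  (forall l, uniq l -> exists2 b, kind_le e b M & {in l, a =1 b}) ->
  kind_le e a M.
Proof.
case: e => [aM k|p p1 aM F].
  have [b bM ->] := aM [:: k] erefl; first exact: bM.
  by rewrite inE.
have [b bM ab] := aM F (fset_uniq F).
by rewrite (eq_big_seq (fun k => b k `^ p)) ?bM// => k /ab ->.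
Qed.

(** This makes the limit of a Cauchy sequence a member of the space. For l^p a single approximation,
    with [eps = 1], already gives a finite norm; for c_0 every [eps] is called upon. *)
Lemma kind_mem_approx e a : (forall k, 0 <= a k) ->
  (forall eps, 0 < eps -> exists b c,
     [/\ (forall k, 0 <= b k), (forall k, 0 <= c k), kind_mem e b,
         kind_le e c eps & forall k, a k <= b k + c k]) ->
  kind_mem e a.
Proof.
move=> a0; case: e => [aP eps eps0|p p1 aP].
  have e2 : 0 < eps / 2 by rewrite divr_gt0.
  have [b [c [_ _ bP cle abc]]] := aP _ e2; have [m bm] := bP _ e2.
  exists m => k /bm bk; apply: le_lt_trans (abc k) _.
  by have := cle k; lra.
have [b [c [b0 c0 bm cle abc]]] := aP 1 ltr01.
apply: kind_mem_mono a0 abc (kind_memD b0 c0 bm _).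
by apply: kind_lp_memP => //; exists 1.
Qed.

Lemma kind_le_shift e a M :
  kind_le e a M -> kind_le e (fun k => a (k + 1)) M.
Proof.
case: e => [aM k|p p1 aM F]; first exact: aM.
have uF : uniq [seq k + 1 | k <- F].
  by rewrite map_inj_uniq ?fset_uniq//; exact: addIr.
by have := kind_le_uniq aM uF; rewrite big_map.
Qed.

Lemma kind_le_single e a (j : int) (M : R) :
  0 <= M -> (forall k, 0 <= a k) -> a j <= M -> (forall k, k != j -> a k = 0) ->
  kind_le e a M.
Proof.
move=> M0 a0 aM aj; case: e => [k|p p1 F] /=.
  by have [->//|/aj ->] := eqVneq k j.
have p0 : 0 < p := lt_le_trans ltr01 p1.
have [jF|jF] := boolP (j \in F).
  rewrite (bigD1_seq j jF (fset_uniq F))/= big1 ?addr0; last first.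
    by move=> k /aj ->; rewrite powR0// gt_eqF.
  by rewrite ge0_ler_powR ?nnegrE ?(ltW p0).
rewrite big1_seq ?powR_ge0// => k /andP[_ kF].
have /aj -> : k != j by apply: contraTneq kF => ->.
by rewrite powR0// gt_eqF.
Qed.

Lemma kind_mem_single e a (j : int) :
  (forall k, 0 <= a k) -> (forall k, k != j -> a k = 0) -> kind_mem e a.
Proof.
move=> a0 aj; case: e => [eps eps0|p p1].
  by exists `|j|.+1 => k kj; rewrite aj//; apply: contraTneq kj => ->; rewrite ltnn.
apply: kind_lp_memP => //; exists (a j + 1); first by rewrite ltr_wpDl.
by apply: (@kind_le_single _ _ j) => //; rewrite ?addr_ge0// lerDl.
Qed.

Definition int_range (N : nat) : seq int :=
  [seq i%:Z - N%:Z | i <- iota 0 (N + N).+1].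

Lemma int_range_uniq N : uniq (int_range N).
Proof. by rewrite map_inj_uniq ?iota_uniq// => i j; lia. Qed.

Lemma mem_int_range N k : (k \in int_range N) = (- N%:Z <= k <= N%:Z).
Proof.
apply/mapP/idP => [[i]|kN]; first by rewrite mem_iota => ? ->; lia.
exists `|(k + N%:Z)%R|%N; last by lia.
by rewrite mem_iota; lia.
Qed.

Lemma seq_sub_int_range (l : seq int) :
  exists N0, forall N, (N0 <= N)%N -> {subset l <= int_range N}.
Proof.
exists (\sum_(k <- l) `|k|)%N => N N0 k kl; rewrite mem_int_range.
have : (`|k| <= \sum_(k <- l) `|k|)%N by rewrite (big_rem k)//= leq_addr.
lia.
Qed.

(** For l^p, choose a finite set whose sum is within [eps]^ p[of the supremum of all finite sums; a
    finite set disjoint from it contributes less than]eps [^ p]. *)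
Lemma kind_le_tail e a (eps : R) :
  (forall k, 0 <= a k) -> kind_mem e a -> 0 < eps ->
  exists N0, forall N, (N0 <= N)%N ->
    kind_le e (fun k => if k \in int_range N then 0 else a k) eps.
Proof.
move=> a0 am eps0; case: e am => [|p p1] am.
  have [m aP] := am eps eps0; exists m => N mN k.
  case: ifPn => [_|]; first exact: ltW.
  by rewrite mem_int_range => kN; apply/ltW/aP; lia.
have p0 : 0 < p := lt_le_trans ltr01 p1.
pose S := [set \sum_(k <- l) a k `^ p | l in [set l : seq int | uniq l]].
have supS : has_sup S.
  split; first by exists (\sum_(k <- [::]) a k `^ p); exists [::].
  exists (kind_norm (kind_lp p1) a `^ p) => _ [l ul <-].
  exact: kind_le_uniq (kind_mem_le a0 am) ul.
have ep0 : 0 < eps `^ p by exact: powR_gt0.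
have [_ [l ul <-] Sl] := sup_adherent ep0 supS.
have [N0 lN] := seq_sub_int_range l; exists N0 => N /lN {}lN G /=.
have -> : \sum_(k <- G) (if k \in int_range N then 0 else a k) `^ p =
    \sum_(k <- [seq k <- G | k \notin int_range N]) a k `^ p.
  rewrite big_filter [RHS]big_mkcond; apply: eq_bigr => k _.
  by case: ifP => // _; rewrite powR0// gt_eqF.
(* The concatenation has no repetition: [l] lies inside [-N, N] and the filtered list outside. *)
have : \sum_(k <- l ++ [seq k <- G | k \notin int_range N]) a k `^ p <= sup S.
  apply: sup_upper_bound => //; eexists; last by [].
  rewrite /= cat_uniq ul filter_uniq ?fset_uniq//= andbT; apply/hasPn => k.
  by rewrite mem_filter => /andP[kN _]; apply: contra kN; exact: lN.
by rewrite big_cat /=; lra.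
Qed.

End Kind.

(** * Finitely supported vectors, completeness and separability of the sequence space *)

Section SequenceSpace.
Variables (R : realType) (s : scalars).
Local Notation K := (scalar_field R s).
Variables (X : int -> completeNormedModType K) (e : seq_kind R).
Local Notation Y := (seq_space X e).

Lemma cast_index_id i (h : i = i) (x : X i) : cast_index h x = x.
Proof. by rewrite (Prop_irrelevance h erefl). Qed.

Lemma cast_index_trans i j k (h : i = j) (h' : j = k) (h'' : i = k) (x : X i) :
  cast_index h' (cast_index h x) = cast_index h'' x.
Proof. by case: _ / h' h''; case: _ / h => h''; rewrite !cast_index_id. Qed.

Lemma cast_indexD i j (h : i = j) (x y : X i) :
  cast_index h (x + y) = cast_index h x + cast_index h y.
Proof. by case: _ / h. Qed.

Lemma cast_indexZ i j (h : i = j) a (x : X i) :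
  cast_index h (a *: x) = a *: cast_index h x.
Proof. by case: _ / h. Qed.

Lemma rnorm_seqE (x : Y) : rnorm x = kind_norm e (fun k => rnorm (x k)).
Proof. exact: of_realK. Qed.

Lemma rnorm_coord_le (x : Y) k : rnorm (x k) <= rnorm x.
Proof.
rewrite rnorm_seqE.
exact: (kind_norm_ge_pt _ (fun k => rnorm_ge0 (x k)) (seq_valP x)).
Qed.

Lemma rnorm_seq_le (x : Y) M :
  0 <= M -> kind_le e (fun k => rnorm (x k)) M -> rnorm x <= M.
Proof.
by move=> M0 xM; rewrite rnorm_seqE kind_norm_le// => k; exact: rnorm_ge0.
Qed.

Lemma seq_kind_le (x : Y) : kind_le e (fun k => rnorm (x k)) (rnorm x).
Proof.
rewrite rnorm_seqE.
exact: kind_mem_le (fun k => rnorm_ge0 (x k)) (seq_valP x).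
Qed.

Definition single_fun j (x : X j) (k : int) : X k :=
  if j =P k is ReflectT jk then cast_index jk x else 0.

Lemma single_fun_cast j k (jk : j = k) (x : X j) :
  single_fun x k = cast_index jk x.
Proof.
rewrite /single_fun; case: eqP => [jk'|//].
by rewrite (Prop_irrelevance jk' jk).
Qed.

Lemma single_fun_id j (x : X j) : single_fun x j = x.
Proof. exact: (single_fun_cast erefl). Qed.

Lemma single_fun_neq j (x : X j) k : k != j -> single_fun x k = 0.
Proof.
move=> kj; rewrite /single_fun; case: eqP => // jk.
by case/eqP: kj; rewrite jk.
Qed.

Lemma single_funP j (x : X j) : kind_mem e (fun k => rnorm (single_fun x k)).
Proof.
apply: (@kind_mem_single _ _ _ j) => [k|k kj]; first exact: rnorm_ge0.
by rewrite single_fun_neq// rnorm0.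
Qed.

Definition single j (x : X j) : Y := SeqSpace (single_funP x).

Lemma rnorm_single j (x : X j) : rnorm (single x) = rnorm x.
Proof.
apply/eqP; rewrite eq_le; apply/andP; split; last first.
  by rewrite -{1}[x]single_fun_id; exact: (rnorm_coord_le (single x)).
apply: rnorm_seq_le; first exact: rnorm_ge0.
apply: (@kind_le_single _ _ _ j) => [|k||k kj] /=.
- exact: rnorm_ge0.
- exact: rnorm_ge0.
- by rewrite single_fun_id.
- by rewrite single_fun_neq// rnorm0.
Qed.

Lemma single_additive j : {morph @single j : x y / x - y}.
Proof.
move=> x y; apply: seq_space_eq => k /=; have [->|kj] := eqVneq k j.
  by rewrite !single_fun_id.
by rewrite !single_fun_neq// subrr.
Qed.

Lemma seq_sumE (I : Type) (l : seq I) (F : I -> Y) k :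
  (\sum_(i <- l) F i) k = \sum_(i <- l) F i k.
Proof. exact: (big_morph (fun x : Y => x k)). Qed.

(** The family [z] need not belong to the space, whereas its restriction to finitely many indices
    always does. A repeated index would count twice, hence the assumptions [uniq l] below. *)
Definition finsupp_seq (l : seq int) (z : forall k, X k) : Y :=
  \sum_(k <- l) single (z k).

Lemma finsupp_seqE l z k : uniq l ->
  finsupp_seq l z k = if k \in l then z k else 0.
Proof.
move=> ul; rewrite seq_sumE; case: ifPn => kl; last first.
  rewrite big1_seq// => j /andP[_ jl] /=; rewrite single_fun_neq//.
  by apply: contraNneq kl => ->.
rewrite (bigD1_seq k)//= big1 ?addr0 ?single_fun_id// => j jk.
by rewrite single_fun_neq// eq_sym.
Qed.

Lemma finsupp_seqB l (z z' : forall k, X k) :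
  finsupp_seq l z - finsupp_seq l z' = finsupp_seq l (fun k => z k - z' k).
Proof. by rewrite -sumrB; apply: eq_bigr => k _; rewrite single_additive. Qed.

(** The crude triangle inequality does not see [e], which lets one argument treat c_0 and all l^p
    together. *)
Lemma rnorm_finsupp_seq_le l (z : forall k, X k) (d : R) :
  (forall k, k \in l -> rnorm (z k) <= d) ->
  rnorm (finsupp_seq l z) <= (size l)%:R * d.
Proof.
by move=> zd; apply: ler_rnorm_sum => k /zd; rewrite rnorm_single.
Qed.

Lemma rnorm_truncation_le l (x : Y) :
  uniq l -> rnorm (finsupp_seq l x) <= rnorm x.
Proof.
move=> ul; apply: rnorm_seq_le; first exact: rnorm_ge0.
apply: kind_le_mono (seq_kind_le x) => k; first exact: rnorm_ge0.
by rewrite finsupp_seqE//; case: ifP => // _; rewrite rnorm0 rnorm_ge0.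
Qed.

Lemma truncation_cvg (x : Y) (eps : R) : 0 < eps ->
  exists N0, forall N, (N0 <= N)%N ->
    rnorm (x - finsupp_seq (int_range N) x) < eps.
Proof.
move=> eps0; have e2 : 0 < eps / 2 by rewrite divr_gt0.
have [N0 NP] := kind_le_tail (fun k => rnorm_ge0 (x k)) (seq_valP x) e2.
exists N0 => N /NP xN; apply: (@le_lt_trans _ _ (eps / 2)); last by lra.
apply: rnorm_seq_le; first exact: ltW.
apply: kind_le_mono xN => k; first exact: rnorm_ge0.
rewrite /= finsupp_seqE ?int_range_uniq//.
by case: ifP; rewrite ?subrr ?rnorm0// subr0.
Qed.

Lemma kind_le_finsupp_seq (z : forall k, X k) (M : R) :
  (forall l, uniq l -> rnorm (finsupp_seq l z) <= M) ->
  kind_le e (fun k => rnorm (z k)) M.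
Proof.
move=> zM.
apply: kind_le_local => l ul; exists (fun k => rnorm (finsupp_seq l z k)).
  apply: kind_le_weaken (seq_kind_le _); [exact: rnorm_ge0|exact: zM].
by move=> k kl /=; rewrite finsupp_seqE// kl.
Qed.

(** The candidate is the coordinatewise limit. Its distance to [u n] is bounded on every finite set
    of indices by passing through a late [u m]; these bounds then give both membership and
    convergence. *)
Lemma seq_space_complete : seq_complete Y.
Proof.
move=> u r ur r0.
have rp n : 0 <= r n := le_trans (rnorm_ge0 _) (ur n n (leqnn n)).
have coord_cvg k : exists l, forall n, rnorm (l - u n k) <= r n.
  apply: (complete_seq_complete (u := fun n => u n k)) r0 => n m nm.
  exact: le_trans (rnorm_coord_le (u m - u n) k) (ur _ _ nm).
pose l k := projT1 (cid (coord_cvg k)).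
have lP k n : rnorm (l k - u n k) <= r n by rewrite /l; case: cid.
have lu n : kind_le e (fun k => rnorm (l k - u n k)) (r n).
  apply: kind_le_finsupp_seq => t ut; apply/ler_addgt0Pr => eps eps0.
  (* The error [eps] is shared among the coordinates in [t]; the successor avoids division by 0 when
     [t] is empty. *)
  have d0 : 0 < eps / (size t).+1%:R by rewrite divr_gt0.
  have [N rN] := r0 _ d0; pose m := maxn n N.
  have -> : finsupp_seq t (fun k => l k - u n k) =
      finsupp_seq t (u m - u n) + finsupp_seq t (fun k => l k - u m k).
    apply: seq_space_eq => k /=; rewrite !finsupp_seqE//.
    case: ifP => _; last by rewrite addr0.
    by rewrite [RHS]addrC subrKA.
  apply: le_trans (ler_rnormD _ _) (lerD _ _).
    by rewrite (le_trans (rnorm_truncation_le _ _))// ur// leq_maxl.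
  apply: le_trans (rnorm_finsupp_seq_le (d := eps / (size t).+1%:R) _) _.
    by move=> k _; rewrite (le_trans (lP k m))// ltW// rN// leq_maxr.
  have le1 : (size t)%:R / (size t).+1%:R <= 1 :> R.
    by rewrite ler_pdivrMr// mul1r ler_nat.
  by rewrite mulrCA ler_piMr// ltW.
have lm : kind_mem e (fun k => rnorm (l k)).
  apply: kind_mem_approx => [k|eps eps0]; first exact: rnorm_ge0.
  have [n rn] := r0 _ eps0.
  exists (fun k => rnorm (u n k)), (fun k => rnorm (l k - u n k)).
  split=> [k|k|||k]; [exact: rnorm_ge0..|exact: seq_valP| |].
    exact: kind_le_weaken (rp n) (ltW (rn n (leqnn n))) (lu n).
  by rewrite addrC -{1}(subrK (u n k) (l k)) ler_rnormD.
exists (SeqSpace lm) => n.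
exact: (@rnorm_seq_le (SeqSpace lm - u n) _ (rp n) (lu n)).
Qed.

(** Not a linear span: each index of [l] contributes one vector of [D k] and no scalars occur, so
    countability is preserved. *)
Fixpoint finite_span (D : forall k, set (X k)) (l : seq int) : set Y :=
  if l is k :: l' then
    [set single p.1 + p.2 | p in D k `*` finite_span D l']
  else [set 0].

Lemma countable_finite_span (D : forall k, set (X k)) l :
  (forall k, countable (D k)) -> countable (finite_span D l).
Proof.
move=> Dc; elim: l => [|k l IH] /=; first exact: countable1.
apply: card_le_trans (card_image_le _ _) _.
exact: countableX.
Qed.

Lemma finite_span_approx (D : forall k, set (X k)) l (z : forall k, X k)
    (eps : R) : (forall k, dense (D k)) -> 0 < eps ->
  exists2 y, finite_span D l y & rnorm (y - finsupp_seq l z) < eps.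
Proof.
move=> Dd; rewrite /finsupp_seq; elim: l eps => [|k l IH] eps eps0 /=.
  by exists 0 => //; rewrite big_nil subrr rnorm0.
have e2 : 0 < eps / 2 by rewrite divr_gt0.
have [y ly yz] := IH _ e2.
have [|x [xz Dx]] := Dd k [set x | rnorm (x - z k) < eps / 2] _ (open_rball _ _).
  by exists (z k); rewrite /= subrr rnorm0.
exists (single x + y); first by exists (x, y).
rewrite big_cons opprD addrACA -single_additive.
apply: le_lt_trans (ler_rnormD _ _) _; rewrite rnorm_single.
by move: xz => /=; lra.
Qed.

(** Truncate to [-N, N], then approximate the remaining coordinates from dense sets; each of the two
    steps costs [r / 2]. *)
Lemma seq_space_separable : (forall k, separable_space (X k)) ->
  separable_space Y.
Proof.
move=> Xs.
have /= DP k := cid2 (Xs k).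
pose D k := s2val (DP k).
have Dc k : countable (D k) by rewrite /D; case: (DP k).
have Dd k : dense (D k) by rewrite /D; case: (DP k).
exists (\bigcup_N finite_span D (int_range N)).
  by apply: bigcup_countable => // N _; exact: countable_finite_span.
move=> A [x Ax] Ao; have [r r0 rA] := open_rnorm Ao Ax.
have r2 : 0 < r / 2 by rewrite divr_gt0.
have [N NP] := truncation_cvg x r2.
have [y Dy yx] := finite_span_approx (int_range N) x Dd r2.
exists y; split; last by exists N.
apply: rA; apply: le_lt_trans (ler_rdistD _ (finsupp_seq (int_range N) x) _) _.
rewrite [r]splitr; apply: ltrD; first exact: yx.
rewrite rdistC; exact: NP.
Qed.

End SequenceSpace.

(** * The shift operator, its iterates, and the two implications involving condition (3) *)

Section ShiftOperator.
Variables (R : realType) (s : scalars).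
Local Notation K := (scalar_field R s).
Variable X : int -> completeNormedModType K.
Variable T : forall k : int, {linear X k -> X (k - 1)}.
Variables (T_bnd : uniformly_bounded T) (e : seq_kind R).
Local Notation Y := (seq_space X e).
Local Notation B := (@op_shift R s X T e T_bnd).

Lemma op_shiftD : {morph B : x y / x + y}.
Proof.
move=> x y; apply: seq_space_eq => k.
by rewrite /= /shift_seq linearD cast_indexD.
Qed.

Lemma op_shift_bounded : exists2 M : R, 0 <= M &
  forall x : Y, rnorm (B x) <= M * rnorm x.
Proof.
have Tle k : (op_norm (T k) <= ereal_sup [set op_norm (T k) | k in setT])%E.
  by apply: ereal_sup_ubound; exists k.
have [M M0 TM] : exists2 M : R, 0 <= M & forall k, (op_norm (T k) <= M%:E)%E.
  (* The supremum is an extended real: a finite value is replaced by its absolute value, and the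
     value -oo by 0. *)
  move: T_bnd Tle; rewrite /uniformly_bounded.
  case: ereal_sup => [M _ TM|oo _|_ TM]; [|by rewrite ltxx in oo|].
    by exists `|M| => // k; rewrite (le_trans (TM k))// lee_fin ler_norm.
  by exists 0 => // k; rewrite (le_trans (TM k))// leNye.
exists M => // x; apply: rnorm_seq_le; first by rewrite mulr_ge0// rnorm_ge0.
have x0 k : 0 <= rnorm (x (k + 1)) := rnorm_ge0 _.
have := kind_leZ x0 (rnorm_ge0 x) M0 (kind_le_shift (seq_kind_le x)).
apply: kind_le_mono => k; first exact: rnorm_ge0.
by rewrite rnorm_cast_index; exact: rnorm_op_norm.
Qed.

Lemma op_shift_continuous : continuous B.
Proof.
have [M M0 BM] := op_shift_bounded.
apply/continuous_rnormP => x eps eps0.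
have M1 : 0 < M + 1 by rewrite ltr_wpDl.
exists (eps / (M + 1)) => [|y yx]; first by rewrite divr_gt0.
rewrite -{1}(subrK x y) op_shiftD addrK; apply: le_lt_trans (BM _) _.
move: yx; rewrite ltr_pdivlMr// => /(le_lt_trans _); apply.
by rewrite mulrC ler_wpM2l ?rnorm_ge0// lerDl.
Qed.

Lemma T_cast_index i j (ij : i = j) (ij1 : i - 1 = j - 1) (x : X i) :
  T j (cast_index ij x) = cast_index ij1 (T i x).
Proof. by case: _ / ij ij1 => ij1; rewrite !cast_index_id. Qed.

Lemma T_compZ k n m (h : n - m%:Z = k) a (x : X n) :
  T_comp T h (a *: x) = a *: T_comp T h x.
Proof.
rewrite /T_comp -cast_indexZ; congr cast_index.
elim: m {h} => [|m IH] /=; first by rewrite cast_indexZ.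
by rewrite IH linearZ/= cast_indexZ.
Qed.

Lemma T_comp0 k n m (h : n - m%:Z = k) : T_comp T h 0 = 0.
Proof. by rewrite -[X in T_comp T h X](scale0r (0 : X n)) T_compZ scale0r. Qed.

(** An arbitrary proof [h] links the indices, so that the formula can be read both at [(j - n, j)]
    and at [(j, j + n)]. *)
Lemma iter_op_shiftE (x : Y) m n k (h : n - m%:Z = k) :
  iter m B x k = T_comp T h (x n).
Proof.
elim: m k h => [|m IH] k h.
  rewrite /T_comp /= (cast_index_trans _ _ (etrans (esym (subr0 n)) h)).
  have nk : n = k by rewrite -h subr0.
  by case: _ / nk h => h; rewrite cast_index_id.
have h1 : n - m%:Z = k + 1 by rewrite -h; lia.
rewrite /= /shift_seq (IH _ h1) /T_comp /=.
have h2 : n - m%:Z - 1 = k + 1 - 1 by rewrite h1.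
rewrite (T_cast_index _ h2).
have h3 : n - m%:Z - 1 = k by rewrite h1 addrK.
by rewrite !(cast_index_trans _ _ h3).
Qed.

Lemma iter_op_shift_single n m k (h : n - m%:Z = k) (x : X n) :
  iter m B (single e x) = single e (T_comp T h x).
Proof.
apply: seq_space_eq => j.
have h' : j + m%:Z - m%:Z = j by rewrite addrK.
rewrite (iter_op_shiftE _ h') /=; have [jn|jn] := eqVneq (j + m%:Z) n.
  have kj : k = j by rewrite -h -jn addrK.
  case: _ / kj h' jn => h' jn; rewrite single_fun_id.
  case: _ / (esym jn) h' => h' {jn}; rewrite single_fun_id.
  by congr T_comp; exact: Prop_irrelevance.
rewrite !single_fun_neq ?T_comp0//.
by apply: contra_neq jn => ->; rewrite -h subrK.
Qed.

Lemma iter_op_shift_sum n (I : Type) (l : seq I) (F : I -> Y) :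
  iter n B (\sum_(i <- l) F i) = \sum_(i <- l) iter n B (F i).
Proof.
apply: (big_morph (iter n B)) => [x y|].
  by elim: n => //= n ->; rewrite op_shiftD.
elim: n => //= n ->.
by apply: (@addIr _ (B 0)); rewrite -op_shiftD !add0r.
Qed.

(** The bound 1 lets the same radius serve for the unit balls of (3). *)
Lemma min_radius (l : seq int) (f : int -> R) :
  exists2 r, 0 < r <= 1 & forall k, k \in l -> 0 < f k -> r <= f k.
Proof.
elim: l => [|j l [r /andP[r0 r1] rP]]; first by exists 1; rewrite ?ltr01 ?lexx.
have [fj|fj] := ltP 0 (f j); last first.
  exists r; rewrite ?r0// => k; rewrite inE => /predU1P[->|/rP//].
  by rewrite ltNge fj.
exists (Num.min r (f j)); first by rewrite lt_min r0 fj ge_min r1.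
move=> k; rewrite inE => /predU1P[-> _|kl k0]; first by rewrite ge_min lexx orbT.
by rewrite ge_min rP.
Qed.

Lemma hypercyclic_shift_condition : hypercyclic B -> shift_condition T.
Proof.
move=> hB N N1 U V UV.
(* Arbitrarily large powers require a nonzero vector. If all the spaces are zero, [n = 1] satisfies
   (3) trivially. *)
have [[k [w w0]]|allz] := pselect (exists k (w : X k), w != 0); last first.
  have z j (x : X j) : x = 0.
    by have [//|x0] := eqVneq x 0; case: allz; exists j, x.
  exists 1%N => // j /UV[_ [u Uu] _ [v Vv]]; split.
    exists 0; split; last exact: ballxx.
    by exists u => //; exact: z.
  exists v; split => //; exists 0; first exact: ballxx.
  by rewrite T_comp0 (z _ v).
have sw0 : single e w != 0.
  apply: contra_neq w0 => sw0; apply: rnorm_eq0.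
  by rewrite -(rnorm_single e) sw0 rnorm0.
have pick (W : forall j, set (X j)) :
    (forall j, - N%:Z <= j <= N%:Z -> open (W j) /\ W j !=set0) ->
    exists (x : forall j, X j) (f : int -> R), forall j, - N%:Z <= j <= N%:Z ->
      0 < f j /\ forall y, rnorm (y - x j) < f j -> W j y.
  move=> WP.
  have xP j : exists p : X j * R, - N%:Z <= j <= N%:Z ->
      0 < p.2 /\ forall y, rnorm (y - p.1) < p.2 -> W j y.
    have [jN|jN] := boolP (- N%:Z <= j <= N%:Z); last by exists (0, 0).
    have [Wo [x Wx]] := WP j jN; have [r r0 rW] := open_rnorm Wo Wx.
    by exists (x, r).
  exists (fun j => (projT1 (cid (xP j))).1), (fun j => (projT1 (cid (xP j))).2).
  by move=> j; case: cid.
have [|u [f fP]] := pick U; first by move=> j /UV[].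
have [|v [g gP]] := pick V; first by move=> j /UV[].
pose l := int_range N.
have lE j : (j \in l) = (- N%:Z <= j <= N%:Z) by exact: mem_int_range.
have ul : uniq l := int_range_uniq N.
have [r /andP[r0 r1] rP] := min_radius l f.
have [t /andP[t0 t1] tP] := min_radius l g.
(* A power beyond 2N puts [j - n] and [j + n] outside [-N, N], where both targets vanish; as [r] and
   [t] are at most 1, the coordinates there lie in unit balls. *)
have [||n nN [z zu zv]] := hypercyclic_transitive sw0 hB (N + N)%N
  (open_rball (finsupp_seq e l u) r) _ (open_rball (finsupp_seq e l v) t) _.
- by exists (finsupp_seq e l u); rewrite /= subrr rnorm0.
- by exists (finsupp_seq e l v); rewrite /= subrr rnorm0.
have zuk j : rnorm (z j - finsupp_seq e l u j) < r.
  exact: le_lt_trans (rnorm_coord_le (z - finsupp_seq e l u) j) zu.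
have zvk j : rnorm (iter n B z j - finsupp_seq e l v j) < t.
  exact: le_lt_trans (rnorm_coord_le (iter n B z - finsupp_seq e l v) j) zv.
exists n; first by lia.
move=> j jN; have jl : j \in l by rewrite lE.
have [fj0 fU] := fP j jN; have [gj0 gV] := gP j jN.
split.
  exists (T_comp T (erefl (j - n%:Z)) (z j)); split.
    exists (z j) => //; apply: fU; apply: lt_le_trans (rP j jl fj0).
    by have := zuk j; rewrite finsupp_seqE// jl.
  rewrite -(of_real1 R s); apply/ball0E; rewrite -(iter_op_shiftE z).
  have := zvk (j - n%:Z); rewrite finsupp_seqE// ifF ?subr0.
    by move=> /lt_le_trans; apply.
  by rewrite lE; lia.
exists (T_comp T (addrK n%:Z j) (z (j + n%:Z))); split.
  exists (z (j + n%:Z)) => //; rewrite -(of_real1 R s); apply/ball0E.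
  have := zuk (j + n%:Z); rewrite finsupp_seqE// ifF ?subr0.
    by move=> /lt_le_trans; apply.
  by rewrite lE; lia.
rewrite -(iter_op_shiftE z); apply: gV; apply: lt_le_trans (tP j jl gj0).
by have := zvk j; rewrite finsupp_seqE// jl.
Qed.

(** Condition (3) only offers balls of radius 1, so it is applied to unit balls around the
    coordinates divided by a small [d]. Multiplying back by [d] leaves an error of at most [d] in
    each of finitely many coordinates. *)
Lemma shift_condition_collapse_blowup : shift_condition T ->
  forall A C W : set Y, open A -> A !=set0 -> open C -> C !=set0 ->
  open W -> W 0 -> exists n x w,
  [/\ A x, W (iter n B x), W w & C (iter n B w)].
Proof.
move=> sT A C W Ao [a Aa] Co [c Cc] Wo W0.
have [r r0 rA] := open_rnorm Ao Aa.
have [t t0 tC] := open_rnorm Co Cc.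
have [q q0 qW] := open_rnorm Wo W0.
have r2 : 0 < r / 2 by rewrite divr_gt0.
have t2 : 0 < t / 2 by rewrite divr_gt0.
have [N1 N1P] := truncation_cvg a r2.
have [N2 N2P] := truncation_cvg c t2.
(* The successor guarantees [1 <= N], as (3) demands. *)
pose N := (N1 + N2).+1; pose l := int_range N.
have {}N1P : rnorm (a - finsupp_seq e l a) < r / 2 by apply: N1P; rewrite /N; lia.
have {}N2P : rnorm (c - finsupp_seq e l c) < t / 2 by apply: N2P; rewrite /N; lia.
have lE j : j \in l -> - N%:Z <= j <= N%:Z by rewrite mem_int_range.
pose b := Num.min (r / 2) (Num.min (t / 2) q).
have b0 : 0 < b by rewrite !lt_min r2 t2.
(* Dividing by one more than the number of coordinates makes the total error strictly less than
   [b]. *)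
pose d := b / (size l).+1%:R.
have d0 : 0 < d by rewrite divr_gt0.
have ld : (size l)%:R * d < b.
  by rewrite mulrCA gtr_pMr// ltr_pdivrMr// mul1r ltr_nat.
have [br [bt bq]] : b <= r / 2 /\ b <= t / 2 /\ b <= q.
  by split; [|split]; rewrite /b !ge_min lexx ?orbT.
pose U (y : Y) j := [set x : X j | rnorm (x - of_real s d^-1 *: y j) < 1].
have dU y j x : U y j x -> rnorm (of_real s d *: x - y j) <= d.
  move=> /ltW; rewrite -(ler_pM2l d0) mulr1 -rnorm_of_realZ ?(ltW d0)//.
  by rewrite scalerBr scalerA -of_realM divff ?gt_eqF// of_real1 scale1r.
have UP y j : open (U y j) /\ U y j !=set0.
  split; first exact: open_rball.
  by exists (of_real s d^-1 *: y j); rewrite /U /= subrr rnorm0.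
have [//|j _|n n0 nP] := sT N _ (U a) (U c).
  by split; by case: (UP a j) (UP c j) => ? ? [].
(* Outside [l] nothing is asked and 0 is a placeholder, so that a choice can be made for every
   [j]. *)
have nP1 j : exists x : X j, j \in l -> U a j x /\
    rnorm (T_comp T (erefl (j - n%:Z)) x) < 1.
  have [jl|jl] := boolP (j \in l); last by exists 0.
  have [[_ [[x Ux <-]]] + _] := nP j (lE j jl).
  by rewrite -(of_real1 R s) => /ball0E ?; exists x.
have nP2 j : exists x : X (j + n%:Z), j \in l -> rnorm x < 1 /\
    U c j (T_comp T (addrK n%:Z j) x).
  have [jl|jl] := boolP (j \in l); last by exists 0.
  have [_ [_ [[x + <-]]]] := nP j (lE j jl).
  by rewrite -(of_real1 R s) => /ball0E ? ?; exists x.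
pose u j := projT1 (cid (nP1 j)); pose w j := projT1 (cid (nP2 j)).
have uP j : j \in l -> U a j (u j) /\ rnorm (T_comp T (erefl (j - n%:Z)) (u j)) < 1.
  by rewrite /u; case: cid.
have wP j : j \in l -> rnorm (w j) < 1 /\ U c j (T_comp T (addrK n%:Z j) (w j)).
  by rewrite /w; case: cid.
have rnormdZ j (x : X j) : rnorm x < 1 -> rnorm (of_real s d *: x) <= d.
  move=> x1; rewrite rnorm_of_realZ ?(ltW d0)//.
  by rewrite ler_piMr// ltW.
exists n, (finsupp_seq e l (fun j => of_real s d *: u j)).
(* Not a [finsupp_seq] over [l]: [w j] lives in [X (j + n)], and only its image under [n] shifts
   sits at index [j]. *)
exists (\sum_(j <- l) single e (of_real s d *: w j)); split.
- apply: rA; apply: le_lt_trans (ler_rdistD _ (finsupp_seq e l a) _) _.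
  rewrite [r]splitr; apply: ltrD; last by rewrite rdistC; exact: N1P.
  apply: lt_le_trans br; apply: le_lt_trans ld; rewrite finsupp_seqB.
  by apply: rnorm_finsupp_seq_le => j /uP[/dU].
- apply: qW; rewrite subr0; apply: lt_le_trans bq; apply: le_lt_trans ld.
  rewrite iter_op_shift_sum; apply: ler_rnorm_sum => j /uP[_ uj].
  rewrite (iter_op_shift_single (erefl (j - n%:Z))) rnorm_single T_compZ.
  exact: rnormdZ.
- apply: qW; rewrite subr0; apply: lt_le_trans bq; apply: le_lt_trans ld.
  by apply: ler_rnorm_sum => j /wP[wj _]; rewrite rnorm_single; exact: rnormdZ.
apply: tC; apply: le_lt_trans (ler_rdistD _ (finsupp_seq e l c) _) _.
rewrite [t]splitr; apply: ltrD; last by rewrite rdistC; exact: N2P.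
apply: lt_le_trans bt; apply: le_lt_trans ld.
have -> : iter n B (\sum_(j <- l) single e (of_real s d *: w j)) =
    finsupp_seq e l (fun j => of_real s d *: T_comp T (addrK n%:Z j) (w j)).
  rewrite iter_op_shift_sum; apply: eq_bigr => j _.
  by rewrite (iter_op_shift_single (addrK n%:Z j)) T_compZ.
rewrite finsupp_seqB; apply: rnorm_finsupp_seq_le => j /wP[_]; exact: dU.
Qed.

End ShiftOperator.

Theorem proposition2p7 (R : realType) (s : scalars)
    (X : int -> completeNormedModType (scalar_field R s))
    (X_sep : forall k : int, separable_space (X k))
    (T : forall k : int, {linear X k -> X (k - 1)})
    (T_cont : forall k : int, continuous (T k))
    (T_bnd : uniformly_bounded T)
    (e : seq_kind R) :
  [<-> hypercyclic (@op_shift R s X T e T_bnd);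
       weakly_mixing (@op_shift R s X T e T_bnd);
       shift_condition T].
Proof.
pose Y := seq_space X e.
have Bc := @op_shift_continuous R s X T T_bnd e.
have sc_wm : shift_condition T -> weakly_mixing (@op_shift R s X T e T_bnd).
  move=> sT; apply: (@birkhoff R s (Y * Y)%type).
  - by apply: prod_seq_complete; exact: seq_space_complete.
  - by apply: separable_prod; exact: seq_space_separable.
  - exact: continuous_direct_sum.
  apply: collapse_blowup_transitive Bc _; first exact: op_shiftD.
  exact: shift_condition_collapse_blowup.
have wm_hc : weakly_mixing (@op_shift R s X T e T_bnd) ->
    hypercyclic (@op_shift R s X T e T_bnd).
  exact: weakly_mixing_hypercyclic.
have hc_sc := @hypercyclic_shift_condition R s X T T_bnd e.
(* The passage from (1) to (2) goes through (3). *)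
tfae => //.
- by move=> /hc_sc/sc_wm.
- by move=> /wm_hc/hc_sc.
- by move=> /sc_wm/wm_hc.
Qed.
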